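(* Greedy matching of a set of $n$ points can be performed in time $O(n^2\log^2 n)$ and space $O(n)$. It can also be performed in time $O(n^2)$.
   Context: The input is a set of $n$ points (arbitrary objects) with a (symmetric) distance function $d$ whose values are only assumed to be totally ordered; each point is stored in constant space, $d$ is evaluated in constant time, and two distances are compared in constant time. The greedy matching is found by repeatedly selecting a pair of distinct remaining points with minimum distance (for a minimum-weight matching) or with maximum distance (for a maximum-weight matching), adding it to the matching, and removing both points, until fewer than two points remain. Ties may be broken arbitrarily. *)

(* Defs.v *)
From mathcomp Require Import all_boot all_order.

Set Implicit Arguments.
Unset Strict Implicit.
Unset Printing Implicit Defensive.

Import Order.TTheory.

(* The model of computation is the unit-cost word RAM, in structured form, with
   points and distances as opaque cell contents.  A program is a finite term
   that mentions neither the number of points, nor the points, nor the distance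
   function, so one program serves all inputs. *)

Inductive value (P D : Type) : Type :=
  | Num of nat
  | Pt of P
  | Dist of D.
Arguments Num {P D} _.
Arguments Pt {P D} _.
Arguments Dist {P D} _.

(* A program mentions finitely many registers, so registers account for O(1)
   space. *)
Record state (P D : Type) : Type := State {
  reg : nat -> value P D;
  mem : nat -> value P D
}.

Definition upd (A : Type) (f : nat -> A) (i : nat) (v : A) : nat -> A :=
  fun j => if j == i then v else f j.

Definition set_reg (P D : Type) (st : state P D) (x : nat) (v : value P D) :=
  State (upd (reg st) x v) (mem st).

Definition set_mem (P D : Type) (st : state P D) (a : nat) (v : value P D) :=
  State (reg st) (upd (mem st) a v).

Inductive arith : Type := Add | Sub | Mul | Div.

Definition arith_eval (o : arith) (a b : nat) : nat :=
  match o with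
  | Add => a + b
  | Sub => a - b
  | Mul => a * b
  | Div => a %/ b
  end.

Inductive cmp_op : Type := CLe | CLt | CEq.

Definition compare (disp : Order.disp_t) (T : orderType disp) (c : cmp_op)
    (x y : T) : bool :=
  match c with
  | CLe => (x <= y)%O
  | CLt => (x < y)%O
  | CEq => x == y
  end.

(* Operands are register names; the target comes first.  In [WriteMem x y] the
   register [x] holds the address. *)
Inductive instr : Type :=
  | Const (x : nat) (a : nat)
  | Move (x y : nat)
  | Arith (o : arith) (x y z : nat)
  | Distance (x y z : nat)
  | ReadMem (x y : nat)
  | WriteMem (x y : nat).

Inductive test : Type := Compare (c : cmp_op) (x y : nat).

Inductive cmd : Type :=
  | Skip
  | Do (i : instr)
  | Seq (c1 c2 : cmd)
  | If (t : test) (c1 c2 : cmd)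
  | While (t : test) (c : cmd).

Section Semantics.

Variables (P : Type) (disp : Order.disp_t) (D : orderType disp).
Variable d : P -> P -> D.
(* Words are the numbers below [W]; memory cells are those of address below
   [S].  Overflow, out-of-range access and ill-typed operands are faults: the
   execution has no result. *)
Variables W S : nat.

Definition step (i : instr) (st : state P D) : option (state P D) :=
  match i with
  | Const x a => if a < W then Some (set_reg st x (Num a)) else None
  | Move x y => Some (set_reg st x (reg st y))
  | Arith o x y z =>
      match reg st y, reg st z with
      | Num a, Num b =>
          if arith_eval o a b < W
          then Some (set_reg st x (Num (arith_eval o a b))) else None
      | _, _ => None
      end
  | Distance x y z =>
      match reg st y, reg st z with
      | Pt p, Pt q => Some (set_reg st x (Dist (d p q)))
      | _, _ => None
      end
  | ReadMem x y =>
      match reg st y with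
      | Num a => if a < S then Some (set_reg st x (mem st a)) else None
      | _ => None
      end
  | WriteMem x y =>
      match reg st x with
      | Num a => if a < S then Some (set_mem st a (reg st y)) else None
      | _ => None
      end
  end.

Definition eval_test (t : test) (st : state P D) : option bool :=
  let: Compare c x y := t in
  match reg st x, reg st y with
  | Num a, Num b => Some (compare c a b)
  | Dist a, Dist b => Some (compare c a b)
  | _, _ => None
  end.

(* [exec c st t st']: from [st], the command [c] terminates in [st'] after [t]
   unit-cost operations (instructions and tests). *)
Inductive exec : cmd -> state P D -> nat -> state P D -> Prop :=
  | ExecSkip st : exec Skip st 1 st
  | ExecDo i st st' : step i st = Some st' -> exec (Do i) st 1 st'
  | ExecSeq c1 c2 st1 st2 st3 t1 t2 :
      exec c1 st1 t1 st2 -> exec c2 st2 t2 st3 ->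
      exec (Seq c1 c2) st1 (t1 + t2) st3
  | ExecIfTrue b c1 c2 st st' t :
      eval_test b st = Some true -> exec c1 st t st' ->
      exec (If b c1 c2) st t.+1 st'
  | ExecIfFalse b c1 c2 st st' t :
      eval_test b st = Some false -> exec c2 st t st' ->
      exec (If b c1 c2) st t.+1 st'
  | ExecWhileTrue b c st1 st2 st3 t1 t2 :
      eval_test b st1 = Some true ->
      exec c st1 t1 st2 -> exec (While b c) st2 t2 st3 ->
      exec (While b c) st1 (t1 + t2).+1 st3
  | ExecWhileFalse b c st :
      eval_test b st = Some false -> exec (While b c) st 1 st.

End Semantics.

Inductive objective : Type := Minimize | Maximize.

Definition at_least_as_good (disp : Order.disp_t) (D : orderType disp)
    (obj : objective) (a b : D) : bool :=
  match obj with
  | Minimize => (a <= b)%O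
  | Maximize => (b <= a)%O
  end.

(* [greedy_run obj d s M]: starting from the points of [s], greedy selection,
   with ties broken arbitrarily, may select exactly the pairs [M], in that
   order. *)
Inductive greedy_run (P : eqType) (disp : Order.disp_t) (D : orderType disp)
    (obj : objective) (d : P -> P -> D) : seq P -> seq (P * P) -> Prop :=
  | GreedyStop s : size s < 2 -> greedy_run obj d s [::]
  | GreedyStep s x y M :
      x \in s -> y \in s -> x != y ->
      (forall u v, u \in s -> v \in s -> u != v ->
         at_least_as_good obj (d x y) (d u v)) ->
      greedy_run obj d [seq z <- s | (z != x) && (z != y)] M ->
      greedy_run obj d s ((x, y) :: M).

(* A matching is a set of pairs: the order in which [M] lists them is
   irrelevant. *)
Definition greedy_matching (P : eqType) (disp : Order.disp_t)
    (D : orderType disp) (obj : objective) (d : P -> P -> D) (s : seq P)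
    (M : seq (P * P)) : Prop :=
  exists2 M', perm_eq M M' & greedy_run obj d s M'.

(* Register 0 holds the number of points, and the points fill the first cells
   of the memory. *)
Definition init_state (P D : Type) (s : seq P) : state P D :=
  State (upd (fun=> Num 0) 0 (Num (size s)))
        (fun a => nth (Num 0) [seq Pt p | p <- s] a).

(* On exit, register 0 holds the number of pairs, and the pairs are listed from
   address 0 on, in two cells each. *)
Definition outputs (P D : Type) (st : state P D) (M : seq (P * P)) : Prop :=
  reg st 0 = Num (size M) /\
  [seq mem st a | a <- iota 0 (2 * size M)]
    = flatten [seq [:: Pt e.1; Pt e.2] | e <- M].

(* On [n] points the program has a memory of [S n] cells, input and output
   included, and words of O(log n) bits, namely numbers below (n + 2) ^ k.
   Without this limit on words, a single cell could encode an entire array. *)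
Definition performs_greedy_matching (obj : objective) (prog : cmd) (k : nat)
    (T S : nat -> nat) : Prop :=
  forall (P : eqType) (disp : Order.disp_t) (D : orderType disp)
         (d : P -> P -> D) (n : nat) (s : seq P),
    size s = n -> uniq s ->
    (forall x y, x \in s -> y \in s -> d x y = d y x) ->
    n <= S n /\
    exists (t : nat) (st : state P D) (M : seq (P * P)),
      [/\ exec d (n.+2 ^ k) (S n) prog (init_state D s) t st,
          t <= T n,
          outputs st M &
          greedy_matching obj d s M].

Definition bigO (f g : nat -> nat) : Prop :=
  exists c n0 : nat, forall n, n0 <= n -> f n <= c * g n.

(* Main.v *)
(* One program, the nearest-neighbour chain, meets both bounds: it takes time
   O(n^2) and works in place in n cells.

   Call a pair of remaining points dominant if each is a nearest neighbour of
   the other.  It stays dominant while other points are removed, so some greedy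
   run selects it, and dominant pairs may be matched in any order.  To find them,
   grow a chain in which every point is followed by a nearest neighbour, until
   the last two points are dominant; match these and resume from what is left of
   the chain.  Each round costs O(n); a round either moves a free point into the
   chain or matches two chain points, so there are O(n) rounds.

   Distances do not increase along the chain, so the earlier chain points need
   not be scanned: the next neighbour is the best among the free points and the
   predecessor.  The memory is a permutation of the input at all times: the
   output pairs, then the free points, then the chain as a downward stack. *)
Require Import Defs.
From mathcomp Require Import all_boot all_order.
From mathcomp Require Import zify.
(* ssrnat shadows the constructor [Num]. *)
Import Defs.

Set Implicit Arguments.
Unset Strict Implicit.
Unset Printing Implicit Defensive.

Section Objective.

Variables (disp : Order.disp_t) (D : orderType disp) (obj : objective).

Lemma good_refl (a : D) : at_least_as_good obj a a.
Proof. by case: obj => /=; exact: Order.POrderTheory.lexx. Qed.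

Lemma good_trans (b a c : D) :
  at_least_as_good obj a b -> at_least_as_good obj b c ->
  at_least_as_good obj a c.
Proof.
case: obj => /= ab bc; first exact: Order.POrderTheory.le_trans ab bc.
exact: Order.POrderTheory.le_trans bc ab.
Qed.

Lemma good_total (a b : D) :
  at_least_as_good obj a b || at_least_as_good obj b a.
Proof. by case: obj => /=; exact: Order.TotalTheory.le_total. Qed.

End Objective.

(** * Greedy runs and dominant pairs *)

Section Greedy.

Variables (P : eqType) (disp : Order.disp_t) (D : orderType disp).
Variables (obj : objective) (d : P -> P -> D).

Lemma greedy_run_perm (s s' : seq P) M :
  perm_eq s s' -> greedy_run obj d s M -> greedy_run obj d s' M.
Proof.
move=> ss' run; elim: run s' ss' => {s M} [s ltn2 | s x y M sx sy xy best _ IH] s' ss'.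
  by apply: GreedyStop; rewrite -(perm_size ss').
apply: GreedyStep; rewrite -?(perm_mem ss') //.
  by move=> u v; rewrite -!(perm_mem ss'); exact: best.
by apply: IH; apply: perm_filter.
Qed.

Lemma greedy_matching_perm (s s' : seq P) M :
  perm_eq s s' -> greedy_matching obj d s M -> greedy_matching obj d s' M.
Proof. by move=> ss' [M' MM' /(greedy_run_perm ss')]; exists M'. Qed.

(* A pair beating every pair that meets it stays so when other points leave,
   so greedy selects it sooner or later, whatever it does before. *)
Lemma greedy_run_insert (s s' : seq P) x y M :
  x \in s -> y \in s -> x != y ->
  (forall u v, u \in s -> v \in s -> u != v ->
     ~~ [&& u != x, u != y, v != x & v != y] ->
     at_least_as_good obj (d x y) (d u v)) ->
  s' = [seq z <- s | (z != x) && (z != y)] ->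
  greedy_run obj d s' M ->
  exists2 M', perm_eq ((x, y) :: M) M' & greedy_run obj d s M'.
Proof.
move=> sx sy xy dom s'E run.
elim: run s sx sy dom s'E => {s' M}
  [s' ltn2 | s' a b M s'a s'b ab best run IH] s sx sy dom s'E.
  exists [:: (x, y)] => //; apply: GreedyStep => //; last by apply: GreedyStop; rewrite -s'E.
  move=> u v su sv uv; apply: dom => //; apply/negP => /and4P[ux uy vx vy].
  have u' : u \in s' by rewrite s'E mem_filter ux uy.
  have v' : v \in s' by rewrite s'E mem_filter vx vy.
  case: s' ltn2 u' v' {s'E} => [|w [|]] //= _.
  by rewrite !inE => /eqP uw /eqP vw; rewrite uw vw eqxx in uv.
(* The better of [(x, y)] and [(a, b)] is a valid first choice in [s]: no pair meeting [x] or [y]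
   beats [(x, y)], and no other pair beats [(a, b)]. *)
have [xyab | abxy] := orP (good_total obj (d x y) (d a b)).
  exists ((x, y) :: (a, b) :: M) => //; apply: GreedyStep => //; last first.
    by rewrite -s'E; apply: GreedyStep.
  move=> u v su sv uv.
  case: (boolP [&& u != x, u != y, v != x & v != y])
    => [/and4P[ux uy vx vy] | ]; last exact: dom.
  apply: good_trans xyab _; apply: best => //; rewrite s'E mem_filter.
    by rewrite ux uy.
  by rewrite vx vy.
move: (s'a) (s'b); rewrite s'E !mem_filter => /andP[/andP[ax ay] sa] /andP[/andP[bx bz] sb].
have [||||M' MM' run'] := IH [seq z <- s | (z != a) && (z != b)].
- by rewrite mem_filter sx andbT eq_sym ax eq_sym.
- by rewrite mem_filter sy andbT eq_sym ay eq_sym.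
- by move=> u v; rewrite !mem_filter => /andP[_ su] /andP[_ sv]; exact: dom.
- by rewrite s'E -!filter_predI; apply: eq_filter => z /=; rewrite andbC.
exists ((a, b) :: M').
  by rewrite (perm_catCA [:: (x, y)] [:: (a, b)] M) /= perm_cons.
apply: GreedyStep => // u v su sv uv.
case: (boolP [&& u != x, u != y, v != x & v != y]) => [/and4P[ux uy vx vy] | no].
  by apply: best => //; rewrite s'E mem_filter ?ux ?uy ?vx ?vy.
by apply: good_trans abxy _; exact: dom.
Qed.

(** Matched points stay in the lowest cells, so the points that remained when the pair at cell [j]
    was matched are those from [j] on; [lo] selects such a stage. *)
Definition closest (m : nat -> P) (lo n x y : nat) : Prop :=
  forall a, lo <= a < n -> a != x -> at_least_as_good obj (d (m x) (m y)) (d (m x) (m a)).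

Fixpoint pairs_from (m : nat -> P) (i h : nat) : seq (P * P) :=
  if h is h'.+1 then (m i, m i.+1) :: pairs_from m i.+2 h' else [::].

Lemma size_pairs_from m i h : size (pairs_from m i h) = h.
Proof. by elim: h i => [|h IH] i //=; rewrite IH. Qed.

Lemma flatten_pairs_from (T : Type) (f : P -> T) m i h :
  flatten [seq [:: f e.1; f e.2] | e <- pairs_from m i h]
    = [seq f (m a) | a <- iota i (2 * h)].
Proof. by elim: h i => [|h IH] i; rewrite ?muln0 ?mulnS //= IH. Qed.

(** Induction from the last pair back: each pair is dominant among the points from its own cell on,
    so [greedy_run_insert] adds it to a run on the later cells. The listed order need not be a
    greedy order. *)
Lemma mutually_closest_greedy (m : nat -> P) n i h :
  i <= n -> (n - i)./2 = h ->
  {in gtn n &, injective m} ->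
  {in gtn n &, forall a b, d (m a) (m b) = d (m b) (m a)} ->
  (forall j, j < h -> closest m (i + j.*2) n (i + j.*2) (i + j.*2).+1 /\
     closest m (i + j.*2) n (i + j.*2).+1 (i + j.*2)) ->
  greedy_matching obj d [seq m a | a <- iota i (n - i)] (pairs_from m i h).
Proof.
move=> + + inj sym; elim: h i => [|h IH] i lein hE cl.
  by exists [::] => //; apply: GreedyStop; rewrite size_map size_iota; lia.
have {}IH : greedy_matching obj d [seq m a | a <- iota i.+2 (n - i.+2)] (pairs_from m i.+2 h).
  apply: IH; [lia|lia|] => j jh.
  have := cl j.+1; rewrite ltnS => /(_ jh).
  by have -> : i + j.+1.*2 = i.+2 + j.*2 by lia.
have [] := cl 0 isT; rewrite addn0 => cl1 cl2.
have [M MM run] := IH.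
have lt1 : i \in gtn n by rewrite inE; lia.
have lt2 : i.+1 \in gtn n by rewrite inE; lia.
have eqm a b : a \in gtn n -> b \in gtn n -> (m a == m b) = (a == b).
  by move=> an bn; apply/eqP/eqP => [/inj|->]; [apply|].
have -> : n - i = (n - i.+2).+2 by lia.
have [|||||M' M'M run'] := @greedy_run_insert [seq m a | a <- iota i (n - i.+2).+2]
   [seq m a | a <- iota i.+2 (n - i.+2)] (m i) (m i.+1) M _ _ _ _ _ run.
- by rewrite /= !inE eqxx.
- by rewrite /= !inE eqxx orbT.
- by rewrite eqm //; lia.
- move=> _ _ /mapP[a ai ->] /mapP[b bi ->].
  move: ai bi; rewrite !mem_iota => ai bi.
  have an : a \in gtn n by rewrite inE; lia.
  have bn : b \in gtn n by rewrite inE; lia.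
  rewrite !eqm // => ab.
  have [ai'|ai'] := eqVneq a i; first by rewrite ai'; move=> _; apply: cl1; lia.
  have [ai2|ai2] := eqVneq a i.+1.
    by rewrite (sym i) // ai2 => _; apply: cl2; lia.
  have [bi'|bi'] := eqVneq b i; first by rewrite (sym a) // bi' => _; apply: cl1; lia.
  have [bi2 _|//] := eqVneq b i.+1.
  by rewrite (sym i) // (sym a) // bi2; apply: cl2; lia.
- rewrite /= !eqxx andbF /=; apply/esym/all_filterP/allP => z /mapP[a].
  rewrite mem_iota => ai ->.
  have an : a \in gtn n by rewrite inE; lia.
  by rewrite !eqm //; lia.
by exists M' => //=; apply: perm_trans M'M; rewrite perm_cons.
Qed.

End Greedy.

(** * Transpositions of memory cells *)

Definition swap_index (i j a : nat) : nat :=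
  if a == i then j else if a == j then i else a.

Ltac swap_lia := rewrite /swap_index; repeat case: ifP; lia.

Lemma swap_index_lt n i j a : i < n -> j < n -> (swap_index i j a < n) = (a < n).
Proof. by move=> ? ?; swap_lia. Qed.

Lemma swap_indexK i j : involutive (swap_index i j).
Proof. by move=> a; swap_lia. Qed.

Lemma perm_swap_index (T : eqType) (m : nat -> T) n i j :
  i < n -> j < n ->
  perm_eq [seq m (swap_index i j a) | a <- iota 0 n] [seq m a | a <- iota 0 n].
Proof.
move=> lti ltj; rewrite (map_comp m); apply/perm_map/uniq_perm => [||a].
- by rewrite (map_inj_uniq (can_inj (swap_indexK i j))) iota_uniq.
- exact: iota_uniq.
rewrite -{1}[a](swap_indexK i j) (mem_map (can_inj (swap_indexK i j))).
by rewrite !mem_iota /= swap_index_lt.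
Qed.

(** * The nearest-neighbour chain in a permuted input *)

Section Chain.

Variables (P : eqType) (disp : Order.disp_t) (D : orderType disp).
Variables (obj : objective) (d : P -> P -> D) (n : nat) (s : seq P).
Hypothesis dC : forall x y, x \in s -> y \in s -> d x y = d y x.

(* The points at indices below [L] are already matched, those at [p] and above
   form the chain, with its top at [p], and each chain element has its successor
   as a nearest neighbour. *)
Record chain_inv (m : nat -> P) (L p : nat) : Prop := ChainInv {
  chain_even : ~~ odd L;
  chain_lb : L <= p;
  chain_ub : p <= n;
  chain_perm : perm_eq [seq m a | a <- iota 0 n] s;
  chain_closest : forall i, p <= i -> i.+1 < n -> closest obj d m L n i.+1 i;
  chain_matched : forall j, j.+1 < L -> ~~ odd j ->
    closest obj d m j n j j.+1 /\ closest obj d m j n j.+1 j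
}.

Lemma chain_inv_mem m L p a : chain_inv m L p -> a < n -> m a \in s.
Proof.
move=> inv lta; rewrite -(perm_mem (chain_perm inv)).
by apply: map_f; rewrite mem_iota.
Qed.

Lemma chain_inv_sym m L p a b : chain_inv m L p -> a < n -> b < n ->
  d (m a) (m b) = d (m b) (m a).
Proof. by move=> inv *; apply: dC; apply: chain_inv_mem inv _. Qed.

Lemma chain_inv_inj m L p : uniq s -> chain_inv m L p -> {in gtn n &, injective m}.
Proof.
by move=> uniqs inv; apply/mkseq_uniqP; rewrite (perm_uniq (chain_perm inv)).
Qed.

Lemma chain_inv_init x0 : size s = n -> chain_inv (nth x0 s) 0 n.
Proof.
move=> sizes; split=> //; first by rewrite -/(mkseq _ _) -sizes mkseq_nth.
by move=> i ni; rewrite ltnNge ltnW.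
Qed.

Lemma chain_inv_start m L : L < n -> chain_inv m L n -> chain_inv m L n.-1.
Proof. by move=> ltL [] *; split=> //; try lia; move=> i; lia. Qed.

(* Distances decrease along the chain, so the chain elements other than the
   predecessor of the top are no closer to the top than the predecessor. *)
Lemma closest_top m L p b :
  chain_inv m L p -> p < n ->
  (forall a, L <= a < n -> a < p \/ a = p.+1 ->
     at_least_as_good obj (d (m p) (m b)) (d (m p) (m a))) ->
  closest obj d m L n p b.
Proof.
move=> inv ltp best a /andP[La an] ap; have lb := chain_lb inv.
have [|ltpa] := ltnP a p; first by move=> ?; apply: best; [lia|left].
have [aE|apS] := eqVneq a p.+1; first by apply: best; [lia|right].
(* Each chain point has its successor, one cell below, as a nearest neighbour, so its link to the
   cell above is no better. *)
have mono k : p + k.+1 < n ->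
    at_least_as_good obj (d (m p) (m p.+1)) (d (m (p + k)) (m (p + k.+1))).
  elim: k => [|k IH] ltk; first by rewrite addn0 addn1 good_refl.
  apply: good_trans (IH _) _; first lia.
  rewrite (chain_inv_sym (b := p + k.+1) inv); [|lia|lia].
  by rewrite [p + k.+1]addnS; apply: chain_closest inv _ _ _ _ _ _; lia.
apply: good_trans (best p.+1 _ _) _; [lia|by right|].
(* Now [a >= p + 2]: its link to [a - 1] is no better than the top link, and its distance to the top
   is no better than that link. *)
have [k aE] : exists k, a = p + k.+1 by exists (a - p).-1; lia.
apply: good_trans (mono k _) _; first by lia.
rewrite (chain_inv_sym inv) 1?(chain_inv_sym (a := p) inv); [|lia..].
rewrite aE addnS; apply: chain_closest inv _ _ _ _ _ _; lia.
Qed.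

(** The swap permutes free cells only, so every range from a cell [lo <= L] up to [n] keeps its
    points, and the only new link runs from [p] to [p - 1]. *)
Lemma chain_inv_push m L p b :
  chain_inv m L p -> p < n -> L <= b < p -> closest obj d m L n p b ->
  chain_inv (m \o swap_index b p.-1) L p.-1.
Proof.
move=> [ev lb ub pm ch mt] ltp lb' cl; split=> //; try lia.
- by rewrite (perm_trans (perm_swap_index _ _ _)) //; lia.
- move=> i pi iltn a an aN; rewrite /=.
  have -> : swap_index b p.-1 i.+1 = i.+1 by swap_lia.
  have [iE|iN] := eqVneq i p.-1.
    have -> : swap_index b p.-1 i = b by swap_lia.
    have -> : i.+1 = p by lia.
    by apply: cl; swap_lia.
  have -> : swap_index b p.-1 i = i by swap_lia.
  by apply: ch => //; swap_lia.
move=> j ltj evj; have [mt1 mt2] := mt j ltj evj.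
split=> a an aN; rewrite /=.
  have -> : swap_index b p.-1 j = j by swap_lia.
  have -> : swap_index b p.-1 j.+1 = j.+1 by swap_lia.
  by apply: mt1; swap_lia.
have -> : swap_index b p.-1 j = j by swap_lia.
have -> : swap_index b p.-1 j.+1 = j.+1 by swap_lia.
by apply: mt2; swap_lia.
Qed.

(** The hypothesis and the chain link from [p + 1] to [p] make the top two points dominant. Cells
    below [L] or above [p + 1] are fixed, so earlier pairs and the rest of the chain survive, even
    if the two swaps overlap. *)
Lemma chain_inv_match m L p :
  chain_inv m L p -> p.+1 < n -> closest obj d m L n p p.+1 ->
  chain_inv (m \o swap_index L p \o swap_index L.+1 p.+1) L.+2 p.+2.
Proof.
move=> [ev lb ub pm ch mt] ltp cl.
pose f a := swap_index L p (swap_index L.+1 p.+1 a).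
have fL : f L = p by rewrite /f; swap_lia.
have fL1 : f L.+1 = p.+1 by rewrite /f; swap_lia.
have flo a : a < L -> f a = a by rewrite /f; swap_lia.
have fhi a : p.+1 < a -> f a = a by rewrite /f; swap_lia.
have frange a : L <= a < n -> L <= f a < n by rewrite /f; swap_lia.
have fE a b : (f a == f b) = (a == b).
  by rewrite /f !(can_eq (swap_indexK _ _)).
have clf lo x y : (forall a, lo <= a < n -> lo <= f a < n) ->
    closest obj d m lo n (f x) (f y) ->
    closest obj d (m \o swap_index L p \o swap_index L.+1 p.+1) lo n x y.
  by move=> flo' cxy a /flo' an aN; apply: cxy; rewrite ?fE.
split=> //.
- by rewrite /= negbK.
- apply: perm_trans pm.
  by apply: perm_trans (perm_swap_index (m \o _) _ _) (perm_swap_index _ _ _); lia.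
- move=> i pi iltn a an; apply: (clf L) => //; last lia.
  by rewrite !fhi; [apply: ch => //; lia|lia..].
move=> j ltj evj; have [jL|Lj] := ltnP j.+1 L.
  have [mt1 mt2] := mt j jL evj.
  have fj : f j = j by apply: flo; lia.
  have fj1 : f j.+1 = j.+1 by apply: flo.
  have flo' a : j <= a < n -> j <= f a < n.
    have [/flo->//|La an] := ltnP a L; have := frange a; lia.
  by split; apply: clf; rewrite ?fj ?fj1.
(* Both [j] and [L] are even, which excludes [j + 1 = L]. *)
have {ltj Lj evj} -> : j = L.
  have [//|LE] : j = L \/ j.+1 = L by lia.
  by move: ev; rewrite -LE /= evj.
by split; apply: clf; rewrite ?fL ?fL1 //; apply: ch.
Qed.

Lemma chain_inv_greedy m L p : uniq s -> chain_inv m L p -> n <= L.+1 ->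
  greedy_matching obj d s (pairs_from m 0 L./2).
Proof.
move=> uniqs inv nL; apply: (greedy_matching_perm (chain_perm inv)).
have lb := chain_lb inv; have ub := chain_ub inv; have ev := chain_even inv.
rewrite -[X in iota 0 X]subn0; apply: mutually_closest_greedy => //.
- by lia.
- exact: chain_inv_inj uniqs inv.
- by move=> a b; exact: chain_inv_sym inv.
by move=> j jh; apply: chain_matched inv _ _ _; [lia|rewrite odd_double].
Qed.

End Chain.

(** * A program logic with time bounds *)

Section TimedHoare.

Variables (P : Type) (disp : Order.disp_t) (D : orderType disp).
Variables (d : P -> P -> D) (W S : nat).

Definition runs_within (c : cmd) (st : state P D) (B : nat)
    (Q : state P D -> Prop) : Prop :=
  exists t st', [/\ exec d W S c st t st', t <= B & Q st'].

Lemma runs_weaken c st B B' (Q Q' : state P D -> Prop) :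
  runs_within c st B Q -> B <= B' -> (forall st', Q st' -> Q' st') ->
  runs_within c st B' Q'.
Proof.
move=> [t [st' [ex tB q]]] BB' QQ'; exists t, st'.
by split; [|exact: leq_trans tB BB'|exact: QQ'].
Qed.

Lemma runs_skip st B (Q : state P D -> Prop) : Q st -> runs_within Skip st B.+1 Q.
Proof. by move=> q; exists 1, st; split=> //; exact: ExecSkip. Qed.

Lemma runs_seq c1 c2 st B1 B2 R Q :
  runs_within c1 st B1 R -> (forall st', R st' -> runs_within c2 st' B2 Q) ->
  runs_within (Seq c1 c2) st (B1 + B2) Q.
Proof.
move=> [t1 [st1 [ex1 le1 r]]] /(_ _ r)[t2 [st2 [ex2 le2 q]]].
exists (t1 + t2), st2; split=> //; first exact: ExecSeq ex1 ex2.
exact: leq_add.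
Qed.

Lemma runs_if b t c1 c2 st B Q :
  eval_test t st = Some b -> runs_within (if b then c1 else c2) st B Q ->
  runs_within (If t c1 c2) st B.+1 Q.
Proof.
move=> eb [t' [st' [ex le q]]]; exists t'.+1, st'; split=> //.
by case: b eb ex; [exact: ExecIfTrue|exact: ExecIfFalse].
Qed.

(** The index of [I] is a variant: at most [v] rounds cost [B] and a test each, and the failing test
    adds the last unit. *)
Lemma runs_while t c B (I : nat -> state P D -> Prop) (Q : state P D -> Prop) v st :
  (forall v st, I v st ->
     exists2 b, eval_test t st = Some b &
       if b then runs_within c st B (fun st' => exists2 v', v' < v & I v' st')
       else Q st) ->
  I v st -> runs_within (While t c) st (v * B.+1).+1 Q.
Proof.
move=> step; elim/ltn_ind: v st => v IH st /[dup] inv /step[[] eb].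
  move=> [t1 [st1 [ex1 le1 [v' ltv inv']]]].
  have [t2 [st2 [ex2 le2 q]]] := IH v' ltv st1 inv'.
  exists (t1 + t2).+1, st2; split=> //; first exact: ExecWhileTrue ex1 ex2.
  have := leq_mul2r B.+1 v'.+1 v; rewrite ltv orbT mulSn; lia.
by move=> q; exists 1, st; split=> //; exact: ExecWhileFalse.
Qed.

Lemma runs_do i c st st1 B Q : step d W S i st = Some st1 ->
  runs_within c st1 B Q -> runs_within (Seq (Do i) c) st B.+1 Q.
Proof.
move=> ei run; rewrite -add1n; apply: (runs_seq (R := eq st1)) => [|_ <- //].
by exists 1, st1; split=> //; exact: ExecDo.
Qed.

Lemma runs_const x a c st B Q : a < W ->
  runs_within c (set_reg st x (Num a)) B Q ->
  runs_within (Seq (Do (Const x a)) c) st B.+1 Q.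
Proof. by move=> aW; apply: runs_do; rewrite /= aW. Qed.

Lemma runs_move x y c st B Q :
  runs_within c (set_reg st x (reg st y)) B Q ->
  runs_within (Seq (Do (Move x y)) c) st B.+1 Q.
Proof. exact: runs_do. Qed.

Lemma runs_arith o x y z a b c st B Q :
  reg st y = Num a -> reg st z = Num b -> arith_eval o a b < W ->
  runs_within c (set_reg st x (Num (arith_eval o a b))) B Q ->
  runs_within (Seq (Do (Arith o x y z)) c) st B.+1 Q.
Proof. by move=> ya zb abW; apply: runs_do; rewrite /= ya zb abW. Qed.

Lemma runs_distance x y z a b c st B Q :
  reg st y = Pt a -> reg st z = Pt b ->
  runs_within c (set_reg st x (Dist (d a b))) B Q ->
  runs_within (Seq (Do (Distance x y z)) c) st B.+1 Q.
Proof. by move=> ya zb; apply: runs_do; rewrite /= ya zb. Qed.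

Lemma runs_read x y a w c st B Q :
  reg st y = Num a -> a < S -> mem st a = w ->
  runs_within c (set_reg st x w) B Q ->
  runs_within (Seq (Do (ReadMem x y)) c) st B.+1 Q.
Proof. by move=> ya aS <-; apply: runs_do; rewrite /= ya aS. Qed.

Lemma runs_write x y a c st B Q :
  reg st x = Num a -> a < S ->
  runs_within c (set_mem st a (reg st y)) B Q ->
  runs_within (Seq (Do (WriteMem x y)) c) st B.+1 Q.
Proof. by move=> xa aS; apply: runs_do; rewrite /= xa aS. Qed.

(** The continuation [c] keeps programs right-nested, as the rules for single instructions require.
    Registers 13 and 14 are scratch. *)
Definition swap_cells (x y : nat) (c : cmd) : cmd :=
  Seq (Do (ReadMem 13 x)) (Seq (Do (ReadMem 14 y))
  (Seq (Do (WriteMem x 14)) (Seq (Do (WriteMem y 13)) c))).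

Lemma runs_swap x y i j c st B Q :
  x < 13 -> y < 13 -> reg st x = Num i -> reg st y = Num j -> i < S -> j < S ->
  (forall st', (forall r, r < 13 -> reg st' r = reg st r) ->
     (forall a, mem st' a = mem st (swap_index i j a)) ->
     runs_within c st' B Q) ->
  runs_within (swap_cells x y c) st B.+4 Q.
Proof.
move=> x13 y13 xi yj iS jS run.
have small r u : r < 13 -> 13 <= u -> (r == u) = false by move=> ? ?; lia.
apply: (runs_read xi iS erefl); apply: (runs_read _ jS erefl).
  by rewrite /= /upd small //; eassumption.
apply: (runs_write _ iS); first by rewrite /= /upd !small //; eassumption.
apply: (runs_write _ jS); first by rewrite /= /upd !small //; eassumption.
apply: run => [r r13|a]; first by rewrite /= /upd !small //; eassumption.
rewrite /= /upd /swap_index /=; have [->|aj] := eqVneq a j; last by case: eqP.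
by case: eqP => // ->.
Qed.

End TimedHoare.

(* The program *)
Infix ";;" := Seq (at level 62, right associativity).

(* Registers: 0 number of points, 1 first unmatched cell and 12 its successor,
   2 top of the chain and 11 its successor, 3 and 4 the constants 1 and 2,
   5 scanned cell, 6 best cell so far, 7 top point, 8 best distance. *)
Definition is_better (obj : objective) (x y : nat) : test :=
  match obj with Minimize => Compare CLt x y | Maximize => Compare CLt y x end.

Definition scan_body (obj : objective) : cmd :=
  Do (ReadMem 9 5) ;; Do (Distance 10 7 9) ;;
  If (is_better obj 10 8) (Do (Move 6 5) ;; Do (Move 8 10) ;; Skip) Skip ;;
  Do (Arith Add 5 5 3) ;; Skip.

(** A chain of one point has no predecessor: register 11 then equals [n], and the first free cell is
    the initial candidate. *)
Definition chain_step (obj : objective) : cmd :=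
  Do (ReadMem 7 2) ;; Do (Arith Add 11 2 3) ;;
  If (Compare CLt 11 0) (Do (Move 6 11) ;; Skip) (Do (Move 6 1) ;; Skip) ;;
  Do (ReadMem 9 6) ;; Do (Distance 8 7 9) ;; Do (Move 5 1) ;;
  While (Compare CLt 5 2) (scan_body obj) ;;
  If (Compare CEq 6 11)
    (swap_cells 1 2 (swap_cells 12 11
      (Do (Arith Add 1 1 4) ;; Do (Arith Add 2 2 4) ;;
       Do (Arith Add 12 12 4) ;; Skip)))
    (Do (Arith Sub 2 2 3) ;; swap_cells 6 2 Skip).

Definition main_loop (obj : objective) : cmd :=
  While (Compare CLt 12 0)
    (If (Compare CEq 2 0) (Do (Arith Sub 2 2 3) ;; Skip) (chain_step obj)).

Definition greedy_prog (obj : objective) : cmd :=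
  Do (Const 3 1) ;; Do (Const 4 2) ;; Do (Move 2 0) ;; Do (Arith Add 12 1 3) ;;
  main_loop obj ;; Do (Arith Div 0 1 4) ;; Skip.

(** * Correctness and running time *)

Section Correctness.

Variables (P : eqType) (disp : Order.disp_t) (D : orderType disp).
Variables (obj : objective) (d : P -> P -> D) (n : nat) (s : seq P).
Hypothesis dC : forall x y, x \in s -> y \in s -> d x y = d y x.

Notation runs := (runs_within d (n.+2 ^ 2) n).
Notation good := (at_least_as_good obj).

(** The program computes only cell indices with small offsets, so the exponent 2 suffices, even for
    [n = 0]. *)
Lemma word_lt a : a <= n.+3 -> a < n.+2 ^ 2.
Proof. by rewrite expnS expn1; nia. Qed.

Record layout (m : nat -> P) (L p : nat) (st : state P D) : Prop := Layout {
  layout_size : reg st 0 = Num n;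
  layout_first : reg st 1 = Num L;
  layout_top : reg st 2 = Num p;
  layout_one : reg st 3 = Num 1;
  layout_two : reg st 4 = Num 2;
  layout_second : reg st 12 = Num L.+1;
  layout_mem : forall a, a < n -> mem st a = Pt (m a)
}.

Lemma layout_set_reg m L p st x v :
  4 < x < 12 -> layout m L p st -> layout m L p (set_reg st x v).
Proof.
move=> xr [r0 r1 r2 r3 r4 r12 memE].
by split; rewrite /= /upd ?ifN //; lia.
Qed.

Lemma eval_is_better (st : state P D) x y a b :
  reg st x = Dist a -> reg st y = Dist b ->
  eval_test (is_better obj x y) st = Some (~~ good b a).
Proof. by rewrite /is_better; case: obj => /= -> -> /=; rewrite Order.TotalTheory.ltNge. Qed.

(** The predecessor [p + 1] counts as examined from the start; for a chain of one point it equals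
    [n] and the bound [a < n] discards it. *)
Record scan_inv (m : nat -> P) (L p b j : nat) (st : state P D) : Prop := ScanInv {
  scan_layout : layout m L p st;
  scan_index : reg st 5 = Num j;
  scan_best : reg st 6 = Num b;
  scan_point : reg st 7 = Pt (m p);
  scan_dist : reg st 8 = Dist (d (m p) (m b));
  scan_pred : reg st 11 = Num p.+1;
  scan_cand : (L <= b < p) || (b == p.+1);
  scan_bn : b < n;
  scan_good : forall a, L <= a < n -> a < j \/ a = p.+1 ->
    good (d (m p) (m b)) (d (m p) (m a))
}.

Lemma runs_scan m L p b st :
  L <= p -> p < n -> scan_inv m L p b L st ->
  runs (While (Compare CLt 5 2) (scan_body obj)) st ((p - L) * 9).+1
    (fun st' => exists b', scan_inv m L p b' p st').
Proof.
move=> Lp pn inv.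
apply: (runs_while (I := fun v st => exists b j,
  [/\ v = p - j, L <= j <= p & scan_inv m L p b j st]));
  last by exists b, L; split; rewrite ?leqnn.
move=> {b st inv} _ st [b [j [-> jrange inv]]].
case: (inv) => -[r0 r1 r2 r3 r4 r12 memE] r5 r6 r7 r8 r11 cand bn best.
exists (j < p); first by rewrite /= r5 r2.
have [jp|pj] := ltnP j p; last first.
  have jE : j = p by lia.
  by subst j; exists b.
apply: (runs_read r5 _ (memE j _)); [lia|lia|].
apply: (runs_distance (a := m p) (b := m j)) => //.
(* Both branches of the conditional meet here: cell [j] has been compared, but register 5 has not
   moved on. The costs 2, 4 and 2 and the loop test give the factor 9. *)
pose R b' st' := [/\ layout m L p st' /\ reg st' 11 = Num p.+1, reg st' 5 = Num j,
  reg st' 6 = Num b', reg st' 7 = Pt (m p) & reg st' 8 = Dist (d (m p) (m b'))].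
pose G b' := [/\ (L <= b' < p) || (b' == p.+1), b' < n &
  forall a, L <= a < n -> a < j.+1 \/ a = p.+1 -> good (d (m p) (m b')) (d (m p) (m a))].
apply: (runs_seq (B1 := 4) (B2 := 2) (R := fun st' => exists2 b', R b' st' & G b'))
  => [|st' [b' [[lay s11] s5 s6 s7 s8] [c' bn' best']]]; last first.
  apply: (runs_arith s5 (layout_one lay)); first by apply: word_lt => /=; lia.
  apply: runs_skip; exists (p - j.+1); first lia.
  exists b', j.+1; split=> //; first lia.
  split=> //; first by case: lay => *; split.
  by rewrite /= addn1.
apply: runs_if.
  by rewrite (eval_is_better (a := d (m p) (m j)) (b := d (m p) (m b))).
case: ifP => [worse|/negbFE bj].
  do 2 apply: runs_move; apply: runs_skip; exists j; first by split.
  split; [lia|lia|] => a an aj.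
  have jb : good (d (m p) (m j)) (d (m p) (m b)).
    by have := good_total obj (d (m p) (m j)) (d (m p) (m b)); rewrite (negbTE worse) orbF.
  have [->|aN] := eqVneq a j; first exact: good_refl.
  by apply: good_trans jb (best a _ _); lia.
apply: runs_skip; exists b; first by split.
split=> // a an aj; have [->//|aN] := eqVneq a j.
by apply: best => //; lia.
Qed.

(** A push lowers [p] by one; a match raises [p] and [L] by two each, so the measure drops by
    two. *)
Lemma runs_chain_step m L p st :
  chain_inv obj d n s m L p -> L.+1 < n -> p < n -> layout m L p st ->
  runs (chain_step obj) st (22 + n * 9) (fun st' => exists m' L' p',
    [/\ 2 * (n - L') + p' < 2 * (n - L) + p, chain_inv obj d n s m' L' p' &
        layout m' L' p' st']).
Proof.
move=> inv Ln pn lay; have Lp := chain_lb inv.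
(* The 13 units pay for the final conditional: a test, two swaps of 4, three additions and
   [Skip]. *)
apply: (runs_weaken (B := (3 + (((p - L) * 9).+1 + 13).+3).+2)
  (Q := fun st' => exists m' L' p',
    [/\ 2 * (n - L') + p' < 2 * (n - L) + p, chain_inv obj d n s m' L' p' &
        layout m' L' p' st'])) => //; last by lia.
case: (lay) => r0 r1 r2 r3 r4 r12 memE.
apply: (runs_read r2 pn (memE p pn)).
apply: (runs_arith (a := p) (b := 1)) => //; first by apply: word_lt => /=; lia.
pose b0 := if p.+1 < n then p.+1 else L.
apply: (runs_seq (R := fun st' => [/\ layout m L p st', reg st' 6 = Num b0,
    reg st' 7 = Pt (m p) & reg st' 11 = Num p.+1])).
  apply: (runs_if (b := p.+1 < n)); first by rewrite /= /upd /= r0 addn1.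
  by rewrite /b0; case: ifP => _; apply: runs_move; apply: runs_skip; split=> //;
    rewrite /= ?addn1.
move=> {lay r0 r1 r2 r3 r4 r12 memE} {}st [lay r6 r7 r11].
case: (lay) => r0 r1 r2 r3 r4 r12 memE.
have b0n : b0 < n by rewrite /b0; case: ifP; lia.
apply: (runs_read r6 b0n (memE b0 b0n)).
apply: (runs_distance (a := m p) (b := m b0)) => //.
apply: runs_move; apply: runs_seq.
  apply: (runs_scan (m := m) (b := b0) Lp pn).
  split; [by do !apply: layout_set_reg|exact: r1|exact: r6|exact: r7|by []
    |exact: r11| |exact: b0n|].
    (* If [p + 1 = n], then [L + 1 < n] puts [L] below [p], so [L] is free. *)
    by rewrite /b0; case: ifP; lia.
  move=> a an [aL|ap]; first lia.
  by rewrite /b0 -ap; case: ifP => [_|]; [exact: good_refl|lia].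
move=> {b0 b0n lay r0 r1 r2 r3 r4 r12 r6 r7 r11 memE} {}st [b [lay _ r6 _ _ r11 cand bn best]].
have cl := closest_top dC inv pn best.
case: (lay) => r0 r1 r2 r3 r4 r12 memE.
apply: (runs_if (b := b == p.+1)); first by rewrite /= r6 r11.
case: eqP => [bE|bN].
  apply: (runs_swap _ _ r1 r2) => [//|//|||st1 reg1 mem1]; [lia|lia|].
  apply: (runs_swap (i := L.+1) (j := p.+1)) => [//|//||||| st2 reg2 mem2];
    rewrite ?reg1 //; [lia|].
  have regE r : r < 13 -> reg st2 r = reg st r by move=> lt; rewrite reg2 ?reg1.
  apply: (runs_arith (a := L) (b := 2)); [by rewrite regE|by rewrite regE| |].
    by apply: word_lt => /=; lia.
  apply: (runs_arith (a := p) (b := 2)); [by rewrite -r2 -regE|by rewrite -r4 -regE| |].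
    by apply: word_lt => /=; lia.
  apply: (runs_arith (a := L.+1) (b := 2)); [by rewrite -r12 -regE|by rewrite -r4 -regE| |].
    by apply: word_lt => /=; lia.
  apply: runs_skip; exists (m \o swap_index L p \o swap_index L.+1 p.+1), L.+2, p.+2.
  split; first lia.
    by apply: chain_inv_match; rewrite -?bE.
  split=> [||||||a an]; rewrite /= /upd /= ?regE ?addn2 //.
  by rewrite mem2 mem1 memE // !swap_index_lt //; lia.
apply: (runs_arith (a := p) (b := 1)) => //; first by apply: word_lt => /=; lia.
apply: (runs_swap (i := b) (j := p.-1)) => [//|//|//||||st1 reg1 mem1];
  [by rewrite /= subn1|lia|lia|].
apply: runs_skip; exists (m \o swap_index b p.-1), L, p.-1.
split; first lia.
  by apply: chain_inv_push => //; lia.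
split; rewrite /= ?reg1 //= ?subn1 // => a an.
by rewrite mem1 /= memE // swap_index_lt //; lia.
Qed.

(** The measure starts at [3 * n], and a round costs at most two tests and a chain step. *)
Lemma runs_main_loop m st : chain_inv obj d n s m 0 n -> layout m 0 n st ->
  runs (main_loop obj) st (3 * n * (24 + n * 9)).+1 (fun st' => exists m' L p,
    [/\ chain_inv obj d n s m' L p, layout m' L p st' & n <= L.+1]).
Proof.
move=> inv lay.
apply: (runs_while (I := fun v st => exists m L p,
  [/\ v = 2 * (n - L) + p, chain_inv obj d n s m L p & layout m L p st]));
  last by exists m, 0, n; split=> //; lia.
move=> {m inv lay st} _ st [m [L [p [-> inv lay]]]].
case: (lay) => r0 r1 r2 r3 r4 r12 memE.
exists (L.+1 < n); first by rewrite /= r12 r0.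
have [Ln|nL] := ltnP L.+1 n; last by exists m, L, p.
apply: (runs_if (b := p == n)); first by rewrite /= r2 r0.
case: eqP => [pE|pN].
  apply: (runs_arith (a := p) (b := 1)) => //; first by apply: word_lt => /=; lia.
  apply: runs_skip; exists (2 * (n - L) + n.-1); first lia.
  exists m, L, n.-1; split=> //; first by apply: chain_inv_start; [lia|rewrite -{2}pE].
  by split=> //; rewrite /= pE subn1.
have pn : p < n by have := chain_ub inv; lia.
apply: runs_weaken (runs_chain_step inv Ln pn lay) (leqnn _) _.
move=> st' [m' [L' [p' [lt inv' lay']]]].
by exists (2 * (n - L') + p') => //; exists m', L', p'.
Qed.

End Correctness.

(** The 7 counts four initial instructions, the last loop test, the division and [Skip]. *)
Definition greedy_time (n : nat) : nat := 7 + 3 * n * (24 + n * 9).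

Lemma greedy_prog_correct (obj : objective) :
  performs_greedy_matching obj (greedy_prog obj) 2 greedy_time id.
Proof.
move=> P disp D d _ s <- uniqs dC; split=> //.
suff [t [st [ex tT [M [out gr]]]]] : runs_within d ((size s).+2 ^ 2) (size s) (greedy_prog obj)
    (init_state D s) (greedy_time (size s))
    (fun st => exists M, outputs st M /\ greedy_matching obj d s M).
  by exists t, st, M; split.
apply: (runs_weaken (B := ((3 * size s * (24 + size s * 9)).+1 + 2).+4)
  (Q := fun st => exists M, outputs st M /\ greedy_matching obj d s M)) => //;
  last by rewrite /greedy_time; lia.
apply: runs_const; first exact: word_lt.
apply: runs_const; first exact: word_lt.
apply: runs_move; apply: (runs_arith (a := 0) (b := 1)) => //.
(* Without a first point there is no default for [nth], hence no [m]; here the loop test [1 < 0]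
   fails at once. *)
case: s => [|x0 s'] in uniqs dC *.
  apply: (runs_seq (B1 := 1) (R := fun st => reg st 1 = Num 0 /\ reg st 4 = Num 2)).
    exists 1; eexists; split; [exact: ExecWhileFalse|by []|by []].
  move=> st [r1 r4]; apply: (runs_arith r1 r4) => //; apply: runs_skip.
  by exists [::]; split=> //; exists [::] => //; exact: GreedyStop.
set s := x0 :: s' in uniqs dC *.
apply: runs_seq.
  apply: (@runs_main_loop _ _ _ _ _ _ s dC (nth x0 s)); first exact: chain_inv_init.
  by split=> // a an; exact: (nth_map x0).
move=> st [m [L [p [inv [r0 r1 r2 r3 r4 r12 memE] nL]]]].
have Ls : L <= size s by exact: leq_trans (chain_lb inv) (chain_ub inv).
apply: (runs_arith r1 r4).
  by apply: word_lt; rewrite /arith_eval divn2; move: Ls; case: (size s) => *; lia.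
apply: runs_skip; exists (pairs_from m 0 L./2); split;
  last exact: (chain_inv_greedy dC uniqs inv nL).
split; first by rewrite size_pairs_from /= divn2.
rewrite size_pairs_from flatten_pairs_from; apply/eq_in_map => a.
rewrite mem_iota => aL; apply: memE.
by apply: leq_trans Ls; lia.
Qed.

Lemma greedy_time_quadratic n : 0 < n -> greedy_time n <= 200 * n ^ 2.
Proof. by rewrite /greedy_time expnS expn1; nia. Qed.

Theorem theorem6 (obj : objective) :
  (exists (prog : cmd) (k : nat) (T S : nat -> nat),
     [/\ performs_greedy_matching obj prog k T S,
         bigO T (fun n => n ^ 2 * trunc_log 2 n ^ 2) &
         bigO S (fun n => n)]) /\
  (exists (prog : cmd) (k : nat) (T S : nat -> nat),
     performs_greedy_matching obj prog k T S /\
     bigO T (fun n => n ^ 2)).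
Proof.
split; exists (greedy_prog obj), 2, greedy_time, id.
  split; first exact: greedy_prog_correct.
    (* From [n = 2] on, [trunc_log 2 n] is positive, so the quadratic bound implies this one. *)
    exists 200, 2 => n n2; apply: leq_trans (greedy_time_quadratic _) _; first lia.
    rewrite mulnA leq_pmulr // expn_gt0 trunc_log_gt0 //; lia.
  by exists 1, 0 => n _; rewrite mul1n.
split; first exact: greedy_prog_correct.
by exists 200, 1 => n; exact: greedy_time_quadratic.
Qed.
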